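(* Let $W=(N,w,\tau)$ be a TPWN with $N=(P,T,F,i,o)$, let $\gamma$ be the earliest-first scheduler, let $H=\max_{t\in T}\tau(t)$ and $H_\bot=\{\bot,0,1,\dots,H\}\subseteq\mathbb{N}_\bot$. There are functions $\nu:T^*\to H_\bot^P$, $f:H_\bot^P\times T\to H_\bot^P$ and $r:H_\bot^P\to\mathbb{N}$ such that for every $\sigma=t_1\dots t_n\in T^*$ compatible with $\gamma$ and every $t\in T$ enabled at the marking reached by $\sigma$: (1) $\gamma(\sigma)=\operatorname{argmin}_{C\in\mathcal{C}(\mathrm{supp}(\nu(\sigma)))}\max_{p\in{}^\bullet C}\nu(\sigma)_p$; (2) $\nu(\sigma t)=f(\nu(\sigma),t)$; (3) $\mathit{time}(\sigma)=\max_{p\in P}\nu(\sigma)_p+\sum_{k=0}^{n-1}r(\nu(t_1\dots t_k))$.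
   Context: A workflow net is $N=(P,T,F,i,o)$: $P,T$ disjoint finite sets, $F\subseteq(P\times T)\cup(T\times P)$, $i$ without incoming arcs, $o$ without outgoing arcs, and $(P\cup T,F\cup\{(o,i)\})$ strongly connected. ${}^\bullet x=\{y:(y,x)\in F\}$, $x^\bullet=\{y:(x,y)\in F\}$, extended to sets by union. Markings, enabledness, firing ($M\xrightarrow{t}M'$: remove a token from each place of ${}^\bullet t$, add one to each place of $t^\bullet$), firing sequences as usual; $\mathbf{i}$ is the marking with a single token in $i$. $N$ is 1-safe if every reachable marking puts at most one token per place; 1-safe markings are identified with sets of places. Transitions are independent if their presets are disjoint, dependent otherwise. At a 1-safe marking $M$, two enabled transitions are concurrent if independent and in conflict if dependent; $C(t,M)$ is the set of transitions in conflict with $t$ at $M$ (contains $t$), and $\mathcal{C}(M)=\{C(t,M):t\text{ enabled at }M\}$. $N$ is confusion-free if for every reachable $M$, every enabled $t$ and every $u$ concurrent with $t$ at $M$: $C(u,M)=C(u,M\setminus{}^\bullet t)=C(u,(M\setminus{}^\bullet t)\cup t^\bullet)$. A TPWN is $W=(N,w,\tau)$ with $N$ 1-safe and confusion-free, $w:T\to\mathbb{Q}_{>0}$, $\tau:T\to\mathbb{N}$. Let $\mathbb{N}_\bot=\{\bot\}\cup\mathbb{N}$ with $\bot\le x$, $\bot+x=\bot$. For $\vec x\in\mathbb{N}_\bot^P$: $upd(\vec x,t)_p=\max_{q\in{}^\bullet t}\vec x_q+\tau(t)$ if $p\in t^\bullet$, $\bot$ if $p\in{}^\bullet t\setminus t^\bullet$,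 $\vec x_p$ otherwise; $\mathrm{supp}(\vec x)=\{p:\vec x_p\ne\bot\}$. The timestamp function $\mu:T^*\to\mathbb{N}_\bot^P$ is $\mu(\epsilon)_i=0$, $\mu(\epsilon)_p=\bot$ ($p\ne i$), $\mu(\sigma t)=upd(\mu(\sigma),t)$; $\mathit{time}(\sigma)=\max_{p\in P}\mu(\sigma)_p$. A scheduler is viewed as a function $\gamma$ assigning to each firing sequence $\mathbf{i}\xrightarrow{\sigma}M$ with $\mathcal{C}(M)\ne\emptyset$ a conflict set $\gamma(\sigma)\in\mathcal{C}(M)$; a firing sequence $\sigma$ is compatible with $\gamma$ if for every decomposition $\sigma=\sigma_1 t\sigma_2$ with $t\in T$ we have $t\in\gamma(\sigma_1)$. The earliest-first scheduler is $\gamma(\sigma)=\operatorname{argmin}_{C\in\mathcal{C}(M)}\max_{p\in{}^\bullet C}\mu(\sigma)_p$ where $\mathbf{i}\xrightarrow{\sigma}M$; here $\operatorname{argmin}$ denotes a minimizing conflict set, ties being broken by a fixed rule (the same rule used in (1)). *)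

(* Defs.v *)
From mathcomp Require Import all_boot all_order all_algebra.

Set Implicit Arguments.
Unset Strict Implicit.
Unset Printing Implicit Defensive.

(* P and T are distinct types, hence disjoint; the flow relation F is given by
   its two components, F :&: (P x T) and F :&: (T x P). *)
Record net := Net {
  place : finType;
  trans : finType;
  arc_pt : place -> trans -> bool;
  arc_tp : trans -> place -> bool;
  source : place;
  sink : place
}.

Definition flow (N : net) : rel (place N + trans N) := fun x y =>
  match x, y with
  | inl p, inr t => arc_pt p t
  | inr t, inl p => arc_tp t p
  | _, _ => false
  end.

Definition closed_flow (N : net) : rel (place N + trans N) := fun x y =>
  flow x y || ((x == inl (sink N)) && (y == inl (source N))).

Definition workflow_net (N : net) : Prop :=
  [/\ forall x, ~~ flow x (inl (source N)),
      forall y, ~~ flow (inl (sink N)) y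
    & forall x y, connect (@closed_flow N) x y].

Definition pre (N : net) (t : trans N) : {set place N} := [set p | arc_pt p t].
Definition post (N : net) (t : trans N) : {set place N} := [set p | arc_tp t p].
Definition preset (N : net) (C : {set trans N}) : {set place N} :=
  \bigcup_(t in C) pre t.

Notation marking N := {ffun place N -> nat}.

Definition init_marking (N : net) : marking N :=
  [ffun p => (p == source N : nat)].

(* The set of places with which a 1-safe marking is identified. *)
Definition marked (N : net) (M : marking N) : {set place N} :=
  [set p | 0 < M p].

(* Enabledness only depends on the set of marked places; for a general marking
   M it reads [enabled (marked M) t], i.e. M p >= 1 for every p in pre t. *)
Definition enabled (N : net) (A : {set place N}) (t : trans N) : bool :=
  pre t \subset A.

Definition fire (N : net) (M : marking N) (t : trans N) : marking N :=
  [ffun p => M p - (p \in pre t) + (p \in post t)].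

Fixpoint firing_seq_from (N : net) (M : marking N) (s : seq (trans N)) : bool :=
  if s is t :: s' then enabled (marked M) t && firing_seq_from (fire M t) s'
  else true.

Definition firing_seq (N : net) (s : seq (trans N)) : bool :=
  firing_seq_from (init_marking N) s.

(* The marking reached by s; only meaningful when [firing_seq s]. *)
Definition reached (N : net) (s : seq (trans N)) : marking N :=
  foldl (@fire N) (init_marking N) s.

Definition reachable (N : net) (M : marking N) : Prop :=
  exists2 s, firing_seq s & M = reached s.

Definition one_safe (N : net) : Prop :=
  forall M : marking N, reachable M -> forall p, M p <= 1.

Definition independent (N : net) (t u : trans N) : bool :=
  [disjoint pre t & pre u].

Definition concurrent (N : net) (A : {set place N}) (t u : trans N) : bool :=
  [&& enabled A t, enabled A u & independent t u].

Definition in_conflict (N : net) (A : {set place N}) (t u : trans N) : bool :=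
  [&& enabled A t, enabled A u & ~~ independent t u].

Definition conflict_set (N : net) (t : trans N) (A : {set place N}) :
    {set trans N} :=
  [set u | in_conflict A t u].

Definition conflict_sets (N : net) (A : {set place N}) : {set {set trans N}} :=
  [set conflict_set t A | t in enabled A].

Definition confusion_free (N : net) : Prop :=
  forall M : marking N, reachable M ->
  forall t u, concurrent (marked M) t u ->
    conflict_set u (marked M) = conflict_set u (marked M :\: pre t) /\
    conflict_set u (marked M :\: pre t) =
      conflict_set u ((marked M :\: pre t) :|: post t).

Record tpwn := TPWN {
  tnet :> net;
  tnet_workflow : workflow_net tnet;
  tnet_safe : one_safe tnet;
  tnet_confusion_free : confusion_free tnet;
  weight : trans tnet -> rat;
  weight_gt0 : forall t, (0 < weight t)%R;
  tau : trans tnet -> nat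
}.

(* N_bot, with None as the bottom element. *)
Notation Nbot := (option nat).

Definition bot_le (x y : Nbot) : bool :=
  match x, y with
  | None, _ => true
  | Some _, None => false
  | Some m, Some n => m <= n
  end.

Definition bot_max (x y : Nbot) : Nbot := if bot_le x y then y else x.

Definition bot_add (x : Nbot) (n : nat) : Nbot := omap (fun m => m + n) x.

Notation stamps N := {ffun place N -> Nbot}.

Definition max_over (N : net) (x : stamps N) (A : {set place N}) : Nbot :=
  \big[bot_max/None]_(p in A) x p.

Definition supp (N : net) (x : stamps N) : {set place N} :=
  [set p | x p != None].

Definition upd (W : tpwn) (x : stamps W) (t : trans W) : stamps W :=
  [ffun p => if p \in post t then bot_add (max_over x (pre t)) (tau t)
             else if p \in pre t then None
             else x p].

Definition mu (W : tpwn) (s : seq (trans W)) : stamps W :=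
  foldl (@upd W) [ffun p => if p == source W then Some 0 else None] s.

Definition time (W : tpwn) (s : seq (trans W)) : Nbot :=
  max_over (mu s) [set: place W].

(* A rule for breaking ties: it picks one element of every nonempty family. *)
Record tie_rule (I : finType) := TieRule {
  tie_pick :> {set I} -> I;
  tie_pickP : forall S : {set I}, S != set0 -> tie_pick S \in S
}.

Definition minimizers (I : finType) (S : {set I}) (v : I -> Nbot) : {set I} :=
  [set C in S | [forall D in S, bot_le (v C) (v D)]].

Definition argmin (I : finType) (tie : tie_rule I) (S : {set I})
    (v : I -> Nbot) : I :=
  tie (minimizers S v).

(* Schedulers are total functions whose values only matter at firing sequences
   reaching a marking with at least one conflict set. *)
Definition is_scheduler (N : net) (g : seq (trans N) -> {set trans N}) : Prop :=
  forall s, firing_seq s -> conflict_sets (marked (reached s)) != set0 ->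
    g s \in conflict_sets (marked (reached s)).

Definition compatible (N : net) (g : seq (trans N) -> {set trans N})
    (s : seq (trans N)) : Prop :=
  firing_seq s /\ forall s1 t s2, s = s1 ++ t :: s2 -> t \in g s1.

Definition earliest_first (W : tpwn) (tie : tie_rule {set trans W})
    (s : seq (trans W)) : {set trans W} :=
  argmin tie (conflict_sets (marked (reached s)))
    (fun C => max_over (mu s) (preset C)).

Lemma minimizers_neq0 (I : finType) (S : {set I}) (v : I -> Nbot) :
  S != set0 -> minimizers S v != set0.
Proof.
case/set0Pn=> x xS; apply/set0Pn.
pose w C := if v C is Some m then m.+1 else 0.
have [C CS minC] := arg_minnP (P := mem S) w xS.
exists C; rewrite inE; apply/andP; split=> //.
apply/forallP=> D; apply/implyP=> /minC; rewrite /w.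
by case: (v C) (v D) => [m|] [n|].
Qed.

Lemma earliest_first_scheduler (W : tpwn) (tie : tie_rule {set trans W}) :
  is_scheduler (earliest_first tie).
Proof.
move=> s _ /minimizers_neq0 nz.
have := tie_pickP tie (nz (fun C => max_over (mu s) (preset C))).
by rewrite inE => /andP[].
Qed.

Definition maxtau (W : tpwn) : nat := \max_(t : trans W) tau t.

(* Vectors over H_bot = {bot, 0, ..., H}, with H = maxtau W. *)
Notation Hstamps W := {ffun place W -> option 'I_(maxtau W).+1}.

Definition Hincl (W : tpwn) (x : Hstamps W) : stamps W :=
  [ffun p => omap (@nat_of_ord _) (x p)].

(* Main.v *)
Require Import Defs.
From mathcomp Require Import all_boot all_order all_algebra.
From mathcomp Require Import zify.

Set Implicit Arguments.
Unset Strict Implicit.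
Unset Printing Implicit Defensive.

(** In a 1-safe confusion-free net, two conflicting enabled transitions always
    have the same start time [max_over (mu s) (pre t)]: postponing every event
    stamped after the start of [t] leaves [t] enabled, and confusion-freeness
    forbids the postponed events from changing the conflict set of [t].  Hence
    under the earliest-first scheduler the start times of the fired transitions
    are nondecreasing.  With [k] the start time of the last fired transition,
    every stamp is at most [k + H] and every enabled transition starts at [k]
    or later, so nothing is lost by replacing each stamp [m] with the truncated
    difference [m - k]. *)

(** * The order on [Nbot] and maxima of stamps *)

(** An order embedding into [nat], so that the results on natural-number maxima carry over. *)
Definition bot_rank (x : Nbot) : nat := if x is Some m then m.+1 else 0.

Lemma bot_leE x y : bot_le x y = (bot_rank x <= bot_rank y).
Proof. by case: x y => [m|] [n|]. Qed.

Lemma bot_rank_inj : injective bot_rank.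
Proof. by case=> [m|] [n|] //= [->]. Qed.

Lemma bot_le_refl x : bot_le x x.
Proof. by rewrite bot_leE. Qed.

Lemma bot_le_trans y x z : bot_le x y -> bot_le y z -> bot_le x z.
Proof. by rewrite !bot_leE; apply: leq_trans. Qed.

Lemma bot_le_anti x y : bot_le x y -> bot_le y x -> x = y.
Proof.
by rewrite !bot_leE => lxy lyx; apply/bot_rank_inj/eqP; rewrite eqn_leq lxy.
Qed.

Lemma bot_le_some m x : bot_le (Some m) x -> exists2 n, x = Some n & m <= n.
Proof. by case: x => // n lmn; exists n. Qed.

Section MaxOver.
Variable N : net.
Implicit Types (x y : stamps N) (A B : {set place N}).

Lemma bot_rank_max_over x A :
  bot_rank (max_over x A) = \max_(p in A) bot_rank (x p).
Proof.
rewrite /max_over; apply: (big_morph bot_rank) => // a b.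
rewrite /bot_max bot_leE; case: leqP => [/maxn_idPr // | /ltnW /maxn_idPl //].
Qed.

Lemma max_over_leP x A b :
  reflect (forall p, p \in A -> bot_le (x p) b) (bot_le (max_over x A) b).
Proof.
rewrite bot_leE bot_rank_max_over.
by apply: (iffP (bigmax_leqP _ _ _)) => le_b p /le_b; rewrite bot_leE.
Qed.

Lemma le_max_over x A p : p \in A -> bot_le (x p) (max_over x A).
Proof. by apply/max_over_leP/bot_le_refl. Qed.

Lemma max_over_sub x A B :
  A \subset B -> bot_le (max_over x A) (max_over x B).
Proof.
by move=> /subsetP sAB; apply/max_over_leP => p /sAB; apply: le_max_over.
Qed.

Lemma eq_max_over x y A :
  (forall p, p \in A -> x p = y p) -> max_over x A = max_over y A.
Proof. exact: eq_bigr. Qed.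

(** Truncated subtraction is monotone and fixes bottom, hence it commutes with maxima. *)
Lemma max_over_subn k x A :
  max_over [ffun p => omap (subn^~ k) (x p)] A =
  omap (subn^~ k) (max_over x A).
Proof.
rewrite /max_over (big_morph (omap (subn^~ k)) (id1 := None) (op1 := bot_max)) //.
  by apply: eq_bigr => p _; rewrite ffunE.
move=> [a|] [b|] //=; rewrite /bot_max /=.
by case: (leqP a b) => lab; case: leqP => //= lab'; congr Some; lia.
Qed.

End MaxOver.

(** * Firing in 1-safe nets *)

Section Firing.
Variable N : net.
Implicit Types (M : marking N) (s : seq (trans N)) (t u e : trans N).

Lemma firing_seq_from_cat M s1 s2 :
  firing_seq_from M (s1 ++ s2) =
  firing_seq_from M s1 && firing_seq_from (foldl (@fire N) M s1) s2.
Proof. by elim: s1 M => //= t s IH M; rewrite IH andbA. Qed.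

Lemma reached_rcons s t : reached (rcons s t) = fire (reached s) t.
Proof. by rewrite /reached -cats1 foldl_cat. Qed.

Lemma firing_seq_rcons s t :
  firing_seq (rcons s t) = firing_seq s && enabled (marked (reached s)) t.
Proof. by rewrite /firing_seq -cats1 firing_seq_from_cat /= andbT. Qed.

Lemma reachable_fire M t :
  reachable M -> enabled (marked M) t -> reachable (fire M t).
Proof.
case=> s fs -> en; exists (rcons s t); last by rewrite reached_rcons.
by rewrite firing_seq_rcons fs.
Qed.

Lemma enabledP M t :
  reflect (forall p, p \in pre t -> 0 < M p) (enabled (marked M) t).
Proof.
apply: (iffP subsetP) => h p /h; first by rewrite inE.
by rewrite inE.
Qed.

Lemma independent_sym t u : independent t u = independent u t.
Proof. by rewrite /independent disjoint_sym. Qed.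

Lemma independent_notin t u p : independent t u -> p \in pre t -> p \notin pre u.
Proof. by move=> ind /(disjointFr ind) ->. Qed.

(** Strong connectedness gives a path from the source to [t]; its last arc cannot be the added one
    from sink to source, which ends in a place. *)
Lemma workflow_pre_neq0 t : workflow_net N -> exists p, p \in pre t.
Proof.
case=> _ _ conn; case/connectP: (conn (inl (source N)) (inr t)) => s.
case/lastP: s => [|s y] //=; rewrite rcons_path last_rcons => /andP[_ e] ety.
move: e; rewrite -ety /closed_flow andbF orbF.
by case: (last _ _) => //= p pt; exists p; rewrite inE.
Qed.

Lemma workflow_post_neq0 t : workflow_net N -> exists p, p \in post t.
Proof.
case=> _ _ conn; case/connectP: (conn (inr t) (inl (source N))).
case=> [|y s] //= /andP[+ _] _; rewrite /closed_flow /= orbF.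
by case: y => //= p tp; exists p; rewrite inE.
Qed.

Hypothesis safeN : one_safe N.

Lemma marked_fire M t : reachable M -> enabled (marked M) t ->
  marked (fire M t) = (marked M :\: pre t) :|: post t.
Proof.
move=> rM en; apply/setP => p; rewrite !inE ffunE !inE.
have := safeN rM p; move/enabledP/(_ p): en; rewrite !inE.
by case: arc_pt; case: arc_tp => /=; lia.
Qed.

Lemma enabled_fire M t e : reachable M -> enabled (marked M) t ->
  enabled (marked M) e -> independent t e -> enabled (marked (fire M t)) e.
Proof.
move=> rM ent ene ind; rewrite marked_fire //; apply/subsetP => p pe.
rewrite !inE; move: (subsetP ene _ pe); rewrite !inE => ->.
rewrite independent_sym in ind.
by have := independent_notin ind pe; rewrite inE => ->.
Qed.

(** If [t] and [e] touched a common place, then, their presets being disjoint, firing one or both of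
    them would put two tokens there. *)
Lemma concurrent_disjoint M t e p : reachable M -> concurrent (marked M) t e ->
  p \in pre t :|: post t -> p \notin pre e :|: post e.
Proof.
move=> rM /and3P[ent ene ind].
have ente := enabled_fire rM ent ene ind.
have rt := reachable_fire rM ent.
have enet := enabled_fire rM ene ent (etrans (independent_sym _ _) ind).
have re := reachable_fire rM ene.
have := safeN (reachable_fire rt ente) p; have := safeN (reachable_fire re enet) p.
have := safeN rt p; have := safeN re p; have := safeN rM p.
have := @independent_notin _ _ p ind.
move/enabledP/(_ p): ent; move/enabledP/(_ p): ene.
rewrite !ffunE !inE.
by case: (arc_pt p t); case: (arc_pt p e); case: (arc_tp t p);
  case: (arc_tp e p) => //=; lia.
Qed.

Lemma fire_comm M t e : reachable M -> concurrent (marked M) t e ->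
  fire (fire M t) e = fire (fire M e) t.
Proof.
move=> rM con; apply/ffunP => p; rewrite !ffunE.
have := @concurrent_disjoint _ _ _ p rM con; rewrite !inE.
by case: (arc_pt p t); case: (arc_pt p e); case: (arc_tp t p);
  case: (arc_tp e p) => //=; lia.
Qed.

(** * Stability of conflict sets under independent events *)

Hypothesis cfN : confusion_free N.

Lemma conflict_set_stable M s t : reachable M -> firing_seq_from M s ->
  enabled (marked M) t -> {in s, forall e, independent e t} ->
  conflict_set t (marked M) = conflict_set t (marked (foldl (@fire N) M s)).
Proof.
elim: s M => //= e s IH M rM /andP[ene fs] ent ind.
have inde : independent e t by apply: ind; rewrite mem_head.
have con : concurrent (marked M) e t by apply/and3P.
rewrite -IH //; first last.
- by move=> x xs; apply: ind; rewrite inE xs orbT.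
- exact: enabled_fire.
- exact: reachable_fire.
by rewrite marked_fire //; have [-> ->] := cfN rM con.
Qed.

(** The middle set of the confusion-freeness condition matters here: [u] stays enabled once the
    tokens of [pre e] are removed, so [u] and [e] are concurrent and touch no common place. *)
Lemma conflict_untouched M s t u : reachable M -> firing_seq_from M s ->
  enabled (marked M) t -> {in s, forall e, independent e t} ->
  u \in conflict_set t (marked M) ->
  {in s, forall e p, p \in pre u -> p \notin pre e :|: post e}.
Proof.
elim: s M => //= e s IH M rM /andP[ene fs] ent ind uC.
have inde : independent e t by apply: ind; rewrite mem_head.
have con : concurrent (marked M) e t by apply/and3P.
have [C1 C2] := cfN rM con.
move=> x; rewrite inE => /orP[/eqP-> p pu|xs].
  have enu : enabled (marked M :\: pre e) u.
    by move: uC; rewrite C1 inE => /and3P[].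
  have indu : independent u e.
    rewrite /independent; apply/pred0P => q /=; apply/negP => /andP[qu qe].
    by have := subsetP enu _ qu; rewrite !inE; rewrite inE in qe; rewrite qe.
  apply: (concurrent_disjoint rM (t := u)); last by rewrite inE pu.
  apply/and3P; split=> //; apply: subset_trans enu _; exact: subsetDl.
apply: (IH _ (reachable_fire rM ene) fs) xs => //.
- exact: enabled_fire.
- by move=> y ys; apply: ind; rewrite inE ys orbT.
- by rewrite marked_fire // -C2 -C1.
Qed.

End Firing.

(** * Timestamps and late events *)

Section Stamps.
Variable W : tpwn.
Implicit Types (M : marking W) (s : seq (trans W)) (t u e : trans W).
Implicit Types x : stamps W.

Let safeW := @tnet_safe W.

Definition stamp x t : Nbot := bot_add (max_over x (pre t)) (tau t).

(* Every event of the sequence produces tokens stamped after time [k]. *)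
Fixpoint late (k : nat) x s : bool :=
  if s is e :: s' then ~~ bot_le (stamp x e) (Some k) && late k (upd x e) s'
  else true.

Lemma updE x t p : upd x t p =
  if p \in post t then stamp x t else if p \in pre t then None else x p.
Proof. by rewrite ffunE. Qed.

Lemma upd_id x t p : p \notin pre t :|: post t -> upd x t p = x p.
Proof. by rewrite updE in_setU negb_or => /andP[/negPf-> /negPf->]. Qed.

Lemma mu_rcons s t : mu (rcons s t) = upd (mu s) t.
Proof. by rewrite /mu -cats1 foldl_cat. Qed.

Lemma supp_mu s : firing_seq s -> supp (mu s) = marked (reached s).
Proof.
elim/last_ind: s => [|s t IH].
  move=> _; apply/setP => p; rewrite /mu /reached /= !inE !ffunE.
  by case: (p == _).
rewrite firing_seq_rcons => /andP[fs en].
have rM : reachable (reached s) by exists s.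
rewrite reached_rcons mu_rcons marked_fire // -(IH fs).
apply/setP => p; rewrite !inE updE !inE.
case: (arc_tp t p); last by case: (arc_pt p t); rewrite /= ?orbF.
rewrite orbT /stamp.
have [q qt] := workflow_pre_neq0 t (tnet_workflow W).
have := le_max_over (mu s) qt; have := subsetP en _ qt.
by rewrite -IH // inE; case: (mu s q) => // m _; case: max_over.
Qed.

Lemma max_over_pre_neq_bot s t : firing_seq s ->
  enabled (marked (reached s)) t -> exists m, max_over (mu s) (pre t) = Some m.
Proof.
move=> fs en; have [q qt] := workflow_pre_neq0 t (tnet_workflow W).
have := le_max_over (mu s) qt; have := subsetP en _ qt.
rewrite -supp_mu // inE; case: (mu s q) => // m _.
by case: max_over => // n _; exists n.
Qed.

Lemma foldl_upd_id x s p :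
  {in s, forall e, p \notin pre e :|: post e} -> foldl (@upd W) x s p = x p.
Proof.
elim: s x => //= e s IH x h; rewrite IH ?upd_id ?h ?mem_head // => y ys.
by apply: h; rewrite inE ys orbT.
Qed.

(** By induction the tail does not touch [p], so [p] already carries [m] right after [e]. Then [e]
    did not produce this token, whose stamp would exceed [k], nor did it only consume from [p],
    which would leave bottom. *)
Lemma late_untouched k x s p m : late k x s ->
  foldl (@upd W) x s p = Some m -> m <= k ->
  {in s, forall e, p \notin pre e :|: post e}.
Proof.
elim: s x => //= e s IH x /andP[ee ls] xp lemk y.
rewrite inE => /orP[/eqP->|]; last exact: IH xp lemk y.
have : upd x e p = Some m.
  by rewrite -xp foldl_upd_id //; apply: IH xp lemk.
rewrite updE !inE negb_or; move: ee; case: ifP => [_ + eqm|_ _].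
  by rewrite eqm /= lemk.
by case: (arc_pt p e).
Qed.

(** * Reordering concurrent events *)

Lemma stamp_upd_disjoint x t e :
  (forall p, p \in pre e -> p \notin pre t :|: post t) ->
  stamp (upd x t) e = stamp x e.
Proof.
by move=> h; rewrite /stamp; congr bot_add; apply: eq_max_over => p /h /upd_id.
Qed.

Lemma upd_comm M x t e : reachable M -> concurrent (marked M) t e ->
  upd (upd x t) e = upd (upd x e) t.
Proof.
move=> rM con.
have d1 p : p \in pre t :|: post t -> p \notin pre e :|: post e.
  exact: concurrent_disjoint rM con.
have d2 p : p \in pre e :|: post e -> p \notin pre t :|: post t.
  by move=> pe; apply/negP => /d1; rewrite pe.
apply/ffunP => p; rewrite [LHS]updE [RHS]updE.
rewrite (@stamp_upd_disjoint x t e); last first.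
  by move=> q qe; apply: d2; rewrite inE qe.
rewrite (@stamp_upd_disjoint x e t); last first.
  by move=> q qt; apply: d1; rewrite inE qt.
rewrite !updE; move: (d1 p); rewrite !inE.
by case: (arc_pt p t); case: (arc_pt p e); case: (arc_tp t p);
  case: (arc_tp e p) => //= /(_ isT).
Qed.

(** Concurrent events touch disjoint places, so [t] moves to the front past one event of [s] at a
    time, without changing the stamps these events produce. *)
Lemma fire_before M x t s k : reachable M -> firing_seq_from M s ->
  enabled (marked M) t -> {in s, forall e, independent e t} ->
  [/\ firing_seq_from (fire M t) s,
      foldl (@fire W) (fire M t) s = fire (foldl (@fire W) M s) t,
      foldl (@upd W) (upd x t) s = upd (foldl (@upd W) x s) t
    & late k x s -> late k (upd x t) s].
Proof.
elim: s M x => //= e s IH M x rM /andP[ene fs] ent ind.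
have inde : independent e t by apply: ind; rewrite mem_head.
have con : concurrent (marked M) t e.
  by apply/and3P; split; rewrite // independent_sym.
have ent' : enabled (marked (fire M e)) t by apply: enabled_fire.
have [|IH1 IH2 IH3 IH4] := IH _ (upd x e) (reachable_fire rM ene) fs ent'.
  by move=> y ys; apply: ind; rewrite inE ys orbT.
rewrite (fire_comm safeW rM con) (upd_comm x rM con); split=> //.
  by rewrite IH1 andbT enabled_fire // independent_sym.
rewrite stamp_upd_disjoint; first by case/andP=> -> /IH4.
move=> p pe; apply/negP => /(concurrent_disjoint safeW rM con).
by rewrite inE pe.
Qed.

(** Induction on [s]: a new late event is appended to [s2], while a new early one moves in front of
    [s2], since it consumes only tokens that [s2] has not touched. *)
Lemma split_early_late k s : firing_seq s -> exists s1 s2,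
  [/\ firing_seq (s1 ++ s2), reached (s1 ++ s2) = reached s,
      mu (s1 ++ s2) = mu s, forall p, bot_le (mu s1 p) (Some k)
    & late k (mu s1) s2].
Proof.
elim/last_ind: s => [_|s t IH].
  by exists [::], [::]; split=> // p; rewrite ffunE; case: ifP.
rewrite firing_seq_rcons => /andP[/[dup] fs /IH[s1 [s2]] [f12 r12 m12 e1 l2] en].
have [early|lt] := boolP (bot_le (stamp (mu s) t) (Some k)); last first.
  exists s1, (rcons s2 t); rewrite -rcons_cat; split=> //.
  - by rewrite firing_seq_rcons f12 r12.
  - by rewrite !reached_rcons r12.
  - by rewrite !mu_rcons m12.
  have: ~~ bot_le (stamp (foldl (@upd W) (mu s1) s2) t) (Some k).
    by move: lt; rewrite -m12 /mu foldl_cat.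
  elim: (s2) (mu s1) l2 => [|e s' IHs] x /=; first by move=> _ ->.
  by case/andP=> -> /IHs.
have f2 : firing_seq_from (reached s1) s2.
  by move: f12; rewrite /firing_seq firing_seq_from_cat => /andP[].
have f1 : firing_seq s1.
  by move: f12; rewrite /firing_seq firing_seq_from_cat => /andP[].
(* The tokens consumed by [t] are stamped no later than those it produces, hence at most [k]. *)
have unt p : p \in pre t -> {in s2, forall e, p \notin pre e :|: post e}.
  move=> pt; have := subsetP en _ pt; rewrite -supp_mu // inE.
  case E: (mu s p) => [m|] // _; apply: (late_untouched l2 (m := m)).
    by rewrite -E -m12 /mu foldl_cat.
  have := le_max_over (mu s) pt; rewrite E => /bot_le_some[n En lemn].
  by move: early; rewrite /stamp En /=; lia.
have eqm p : p \in pre t -> mu s p = mu s1 p.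
  by move=> pt; rewrite -(foldl_upd_id (mu s1) (unt p pt)) -m12 /mu foldl_cat.
have en1 : enabled (marked (reached s1)) t.
  rewrite -supp_mu //; apply/subsetP => p pt; rewrite inE -eqm //.
  by have := subsetP en _ pt; rewrite -supp_mu // inE.
have ind : {in s2, forall e, independent e t}.
  move=> e es; rewrite independent_sym; apply/pred0P => p /=; apply/negP.
  by case/andP=> /unt/(_ _ es); rewrite inE negb_or => /andP[/negPf->].
have rM1 : reachable (reached s1) by exists s1.
have [B1 B2 B3 B4] := fire_before (mu s1) k rM1 f2 en1 ind.
exists (rcons s1 t), s2; rewrite !mu_rcons; split.
- rewrite /firing_seq firing_seq_from_cat -/(firing_seq _) firing_seq_rcons.
  by rewrite f1 en1 -/(reached _) reached_rcons.
- rewrite reached_rcons -r12 /reached !foldl_cat -/(reached _).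
  by rewrite reached_rcons -/(reached _) B2.
- by rewrite -m12 /mu !foldl_cat -/(mu _) mu_rcons -/(mu _) B3.
- move=> p; rewrite updE.
  have -> : stamp (mu s1) t = stamp (mu s) t.
    by rewrite /stamp; congr bot_add; apply: eq_max_over => q /eqm.
  by case: ifP => // _; case: ifP.
exact: B4.
Qed.

(* Postpone all events stamped after the start of [t]; they are then all
   concurrent with [t], so by confusion-freeness none of them can contribute
   to the enabling of [u]. *)
Lemma conflict_start_le s t u : firing_seq s ->
  in_conflict (marked (reached s)) t u ->
  bot_le (max_over (mu s) (pre u)) (max_over (mu s) (pre t)).
Proof.
move=> fs /[dup] tu /and3P[ent enu _].
have [k Ek] := max_over_pre_neq_bot fs ent; rewrite Ek.
have [s1 [s2 [f12 r12 m12 e1 l2]]] := split_early_late k fs.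
have /andP[f1 f2] : firing_seq s1 && firing_seq_from (reached s1) s2.
  by move: f12; rewrite /firing_seq firing_seq_from_cat.
have m2 : mu s = foldl (@upd W) (mu s1) s2 by rewrite -m12 /mu foldl_cat.
have unt p : p \in pre t -> {in s2, forall e, p \notin pre e :|: post e}.
  move=> pt; have := subsetP ent _ pt; rewrite -supp_mu // inE.
  case E: (mu s p) => [m|] // _.
  apply: (late_untouched l2 (m := m)); first by rewrite -m2.
  by have := le_max_over (mu s) pt; rewrite E Ek.
have en1 : enabled (marked (reached s1)) t.
  rewrite -supp_mu //; apply/subsetP => p pt; rewrite inE.
  rewrite -(foldl_upd_id (mu s1) (unt p pt)) -m2.
  by have := subsetP ent _ pt; rewrite -supp_mu // inE.
have ind : {in s2, forall e, independent e t}.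
  move=> e es; rewrite independent_sym; apply/pred0P => p /=; apply/negP.
  by case/andP=> /unt/(_ _ es); rewrite inE negb_or => /andP[/negPf->].
have rM1 : reachable (reached s1) by exists s1.
have cfW := @tnet_confusion_free W.
have uC : u \in conflict_set t (marked (reached s1)).
  rewrite (conflict_set_stable safeW cfW rM1 f2 en1 ind).
  by rewrite -foldl_cat -/(reached _) r12 inE.
have untu := conflict_untouched safeW cfW rM1 f2 en1 ind uC.
(* The stamps on [pre u] are thus those of the early part [s1], all at most [k]. *)
apply/max_over_leP => p pu; rewrite m2 foldl_upd_id // => e es.
exact: untu.
Qed.

Lemma in_conflict_sym (A : {set place W}) t u :
  in_conflict A t u = in_conflict A u t.
Proof. by rewrite /in_conflict independent_sym andbCA. Qed.

Lemma conflict_start_eq s t u : firing_seq s ->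
  in_conflict (marked (reached s)) t u ->
  max_over (mu s) (pre u) = max_over (mu s) (pre t).
Proof.
move=> fs tu; apply: bot_le_anti; apply: conflict_start_le => //.
by rewrite in_conflict_sym.
Qed.

(** Dependence of [t] on itself amounts to its preset being nonempty. *)
Lemma conflict_set_id (A : {set place W}) t :
  enabled A t -> t \in conflict_set t A.
Proof.
move=> en; rewrite inE /in_conflict en /=; apply/pred0Pn.
have [p pt] := workflow_pre_neq0 t (tnet_workflow W).
by exists p; rewrite /= pt.
Qed.

(** All members of a conflict set start at the same time, so the quantity minimized by the scheduler
    is the start time of any one of them. *)
Lemma max_over_preset s C t : firing_seq s ->
  C \in conflict_sets (marked (reached s)) -> t \in C ->
  max_over (mu s) (preset C) = max_over (mu s) (pre t).
Proof.
move=> fs /imsetP[u enu ->] tC; apply: bot_le_anti; last first.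
  by apply: max_over_sub; apply: (bigcup_sup t).
apply/max_over_leP => p /bigcupP[v vC pv].
apply: bot_le_trans (le_max_over _ pv) _; rewrite !inE in tC vC.
rewrite (conflict_start_eq fs tC) (conflict_start_eq fs vC).
exact: bot_le_refl.
Qed.

Lemma conflict_sets_ex (A : {set place W}) C : C \in conflict_sets A ->
  exists2 t, enabled A t & t \in C.
Proof. by case/imsetP=> t en ->; exists t; last exact: conflict_set_id. Qed.

(** * Choices of the earliest-first scheduler *)

Section EarliestFirst.
Variable tie : tie_rule {set trans W}.

Notation gamma := (earliest_first tie).

Lemma compatible_rcons s t : compatible gamma (rcons s t) ->
  compatible gamma s /\ t \in gamma s.
Proof.
case; rewrite firing_seq_rcons => /andP[fs _] comp; split.
  split=> // s1 u s2 E; apply: (comp _ _ (rcons s2 t)).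
  by rewrite E rcons_cat.
by apply: (comp _ _ [::]); rewrite cats1.
Qed.

Lemma earliest_first_min s t u : firing_seq s ->
  t \in gamma s -> enabled (marked (reached s)) t ->
  enabled (marked (reached s)) u ->
  bot_le (max_over (mu s) (pre t)) (max_over (mu s) (pre u)).
Proof.
move=> fs tg ent enu.
have nz : conflict_sets (marked (reached s)) != set0.
  by apply/set0Pn; exists (conflict_set t (marked (reached s))); apply: imset_f.
have := tie_pickP tie (minimizers_neq0 (fun C => max_over (mu s) (preset C)) nz).
rewrite -/(argmin _ _ _) -/(earliest_first tie s) inE => /andP[gC].
have uC : conflict_set u (marked (reached s)) \in
          conflict_sets (marked (reached s)) by apply: imset_f.
move=> /forallP/(_ (conflict_set u (marked (reached s)))).
rewrite uC /= (max_over_preset fs gC tg).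
by rewrite (max_over_preset fs uC (conflict_set_id enu)).
Qed.

(** * Stamps relative to the last start time *)

Definition next_conflict_set (y : stamps W) : {set trans W} :=
  argmin tie (conflict_sets (supp y)) (fun C => max_over y (preset C)).

(** The witness for [r]: the time from the last start to the next one. The default 0 is not reached
    when a compatible sequence is extended by a transition. *)
Definition delay (x : Hstamps W) : nat :=
  odflt 0 (max_over (Hincl x) (preset (next_conflict_set (Hincl x)))).

(* [inord] never truncates along compatible sequences, see [rel_mu_spec]. *)
Definition rel_upd (x : Hstamps W) (t : trans W) : Hstamps W :=
  [ffun p => omap (fun m => inord (m - delay x)) (upd (Hincl x) t p)].

Definition rel_mu s : Hstamps W :=
  foldl rel_upd [ffun p => if p == source W then Some ord0 else None] s.

(** Along a compatible sequence the delays telescope to the start time of the last fired transition,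
    or 0 if there is none. *)
Definition start_time s : nat := \sum_(k < size s) delay (rel_mu (take k s)).

Lemma rel_mu_rcons s t : rel_mu (rcons s t) = rel_upd (rel_mu s) t.
Proof. by rewrite /rel_mu -cats1 foldl_cat. Qed.

Lemma start_time_rcons s t :
  start_time (rcons s t) = start_time s + delay (rel_mu s).
Proof.
rewrite /start_time size_rcons big_ord_recr /= -cats1 take_size_cat //.
by congr addn; apply: eq_bigr => k _; rewrite takel_cat // ltnW.
Qed.

(** Stamps below [k] become 0 and not bottom, so the marking can still be read off. *)
Definition truncated (k : nat) (x : stamps W) : stamps W :=
  [ffun p => omap (subn^~ k) (x p)].

Lemma supp_truncated k x : supp (truncated k x) = supp x.
Proof. by apply/setP => p; rewrite !inE ffunE; case: (x p). Qed.

(** All compared start times are at least [k], where subtracting [k] preserves and reflects the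
    order; the sets of minimizers agree, and so do the tie-breaks. *)
Lemma next_conflict_set_truncated k s : firing_seq s ->
  (forall u, enabled (marked (reached s)) u ->
     bot_le (Some k) (max_over (mu s) (pre u))) ->
  next_conflict_set (truncated k (mu s)) = gamma s.
Proof.
move=> fs ge_k; rewrite /next_conflict_set /earliest_first /argmin.
rewrite supp_truncated supp_mu //; congr (tie _); apply/setP => C.
rewrite !inE; case CS: (C \in _) => //=; apply: eq_forallb => D.
case DS: (D \in _) => //=; rewrite !max_over_subn.
have [t ent tC] := conflict_sets_ex CS; have [u enu uD] := conflict_sets_ex DS.
rewrite (max_over_preset fs CS tC) (max_over_preset fs DS uD).
have /bot_le_some[m -> lekm] := ge_k t ent.
have /bot_le_some[n -> lekn] := ge_k u enu.
by rewrite /=; lia.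
Qed.

(** The upper bound keeps truncated stamps within [maxtau W], the third clause lets the scheduler
    choose from truncated stamps, and the last makes the total time recoverable. *)
Lemma rel_mu_spec s : compatible gamma s ->
  [/\ Hincl (rel_mu s) = truncated (start_time s) (mu s),
      forall p, bot_le (mu s p) (Some (start_time s + maxtau W)),
      forall u, enabled (marked (reached s)) u ->
        bot_le (Some (start_time s)) (max_over (mu s) (pre u))
    & bot_le (Some (start_time s)) (max_over (mu s) [set: place W])].
Proof.
elim/last_ind: s => [|s t IH].
  move=> _; rewrite /start_time big_ord0; split.
  - by apply/ffunP => p; rewrite !ffunE; case: eqP.
  - by move=> p; rewrite ffunE; case: eqP.
  - by move=> u en; have [m ->] := @max_over_pre_neq_bot [::] u isT en.
  apply: bot_le_trans (le_max_over _ (in_setT (source W))).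
  by rewrite ffunE eqxx.
move=> /[dup] comp /compatible_rcons[/[dup] -[fs _] /IH[Hnu ub ge_th _] tg].
have ent : enabled (marked (reached s)) t.
  by case: comp; rewrite firing_seq_rcons => /andP[].
have [m Em] := max_over_pre_neq_bot fs ent.
have le_th_m : start_time s <= m by have := ge_th t ent; rewrite Em.
have gC : gamma s \in conflict_sets (marked (reached s)).
  apply: earliest_first_scheduler => //.
  by apply/set0Pn; exists (conflict_set t (marked (reached s))); apply: imset_f.
have dE : delay (rel_mu s) = m - start_time s.
  rewrite /delay Hnu next_conflict_set_truncated // max_over_subn.
  by rewrite (max_over_preset fs gC tg) Em.
have thE : start_time (rcons s t) = m.
  by rewrite start_time_rcons dE subnKC.
have st : stamp (mu s) t = Some (m + tau t) by rewrite /stamp Em.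
have le_tau : tau t <= maxtau W by apply: leq_bigmax.
have ub' p : bot_le (mu (rcons s t) p) (Some (m + maxtau W)).
  rewrite mu_rcons updE st; case: ifP => [_|_] /=; first by lia.
  case: ifP => // _; apply: bot_le_trans (ub p) _; rewrite /=; lia.
rewrite thE; split=> //.
(* A new stamp becomes [tau t]. An old stamp [a] is truncated twice, by [start_time s] and by the
   delay, which amounts to [a - m] because [start_time s <= m]. Both are at most [maxtau W]. *)
- apply/ffunP => p; rewrite rel_mu_rcons [LHS]ffunE [RHS]ffunE.
  rewrite [rel_upd _ _ _]ffunE updE Hnu /stamp.
  move: (ub' p); rewrite mu_rcons updE dE max_over_subn Em st.
  case: ifP => _ /=.
    by move=> _; rewrite inordK; [congr Some|]; lia.
  case: ifP => //= _; rewrite ffunE; case: (mu s p) => //= a le_a.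
  by rewrite inordK; [congr Some|]; lia.
- move=> u; rewrite reached_rcons marked_fire //; last by exists s.
  move=> /subsetP enu; rewrite mu_rcons.
  (* Either [u] consumes a token produced by [t], stamped [m + tau t], or it was already enabled
     before [t] and the scheduler preferred [t]. *)
  have [/existsP[p /andP[pu pt]]|no] :=
      boolP [exists p, (p \in pre u) && (p \in post t)].
    apply: bot_le_trans (le_max_over _ pu).
    by rewrite updE pt st /=; lia.
  have keep p : p \in pre u ->
      (p \notin post t) && (p \in marked (reached s) :\: pre t).
    move=> pu; have npt : p \notin post t.
      by apply: contra no => pt; apply/existsP; exists p; rewrite pu.
    by rewrite npt; move: (enu p pu); rewrite in_setU (negPf npt) orbF.
  have -> : max_over (upd (mu s) t) (pre u) = max_over (mu s) (pre u).
    apply: eq_max_over => p /keep; rewrite in_setD updE.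
    by case/and3P=> /negPf-> /negPf->.
  rewrite -Em; apply: earliest_first_min => //.
  by apply/subsetP => p /keep; rewrite in_setD => /and3P[].
(* Some place receives a token from [t], stamped at least [m]. *)
have [p pt] := workflow_post_neq0 t (tnet_workflow W).
apply: bot_le_trans (le_max_over _ (in_setT p)).
by rewrite mu_rcons updE pt st /=; lia.
Qed.

End EarliestFirst.
End Stamps.

(** * Scheduling and timing from bounded stamps *)

Theorem theorem2 (W : tpwn) (tie : tie_rule {set trans W}) :
  exists (nu : seq (trans W) -> Hstamps W)
         (f : Hstamps W -> trans W -> Hstamps W)
         (r : Hstamps W -> nat),
    forall (sigma : seq (trans W)) (t : trans W),
      compatible (earliest_first tie) sigma ->
      enabled (marked (reached sigma)) t ->
      [/\ earliest_first tie sigma =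
            argmin tie (conflict_sets (supp (Hincl (nu sigma))))
              (fun C => max_over (Hincl (nu sigma)) (preset C)),
          nu (rcons sigma t) = f (nu sigma) t
        & time sigma =
            bot_add (max_over (Hincl (nu sigma)) [set: place W])
              (\sum_(k < size sigma) r (nu (take k sigma)))].
Proof.
exists (rel_mu tie), (rel_upd tie), (delay tie) => s t comp _.
have [Hnu _ ge_th ge_time] := rel_mu_spec comp; have [fs _] := comp.
split; last 1 first.
- rewrite Hnu max_over_subn /time -/(start_time tie s).
  (* The largest stamp is at least the last start time, so adding the subtracted amount back is
     exact. *)
  by case/bot_le_some: ge_time => m -> le_m; rewrite /= subnK.
- by rewrite Hnu -(next_conflict_set_truncated tie fs ge_th).
- exact: rel_mu_rcons.
Qed.
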